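(* There is a distinct covering system with minimum modulus $6$ and maximum modulus $168$. That is, there exists a covering system $\{a_1 \pmod{m_1}, \ldots, a_n \pmod{m_n}\}$ with $m_i \neq m_j$ whenever $i \neq j$, $\min_i m_i = 6$ and $\max_i m_i = 168$.
   Context: For an integer $a$ and a positive integer $m$, the arithmetic progression $a \pmod{m}$ is the set $\{a+km : k \in \mathbb{Z}\}$, and $m$ is called its modulus. A covering system is a finite set of arithmetic progressions $\{a_1 \pmod{m_1}, \ldots, a_n \pmod{m_n}\}$ such that every integer belongs to at least one of them. It is called distinct if $m_i \neq m_j$ whenever $i \neq j$. *)

(* Defs.v *)
From mathcomp Require Import all_boot all_order all_algebra.

Set Implicit Arguments.
Unset Strict Implicit.
Unset Printing Implicit Defensive.

Import GRing.Theory.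

(* The pair (a, m) stands for the progression a (mod m); positivity of the
   modulus is imposed in [covering_system]. *)
Definition progression : Type := (int * nat)%type.

Definition modulus (p : progression) : nat := p.2.

Definition in_progression (p : progression) (x : int) : Prop :=
  exists k : int, x = (p.1 + k * (modulus p)%:Z)%R.

(* A finite family {a_1 (mod m_1), ..., a_n (mod m_n)} is given by the list of
   the pairs (a_i, m_i); the order of the list is irrelevant. *)
Definition covering_system (s : seq progression) : Prop :=
  (forall p, p \in s -> 0 < modulus p) /\
  (forall x : int, exists2 p, p \in s & in_progression p x).

(* m_i <> m_j for positions i <> j *)
Definition distinct_moduli (s : seq progression) : Prop :=
  uniq [seq modulus p | p <- s].

Definition minimum_modulus (s : seq progression) (m : nat) : Prop :=
  (exists2 p, p \in s & modulus p = m) /\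
  (forall p, p \in s -> m <= modulus p).

Definition maximum_modulus (s : seq progression) (m : nat) : Prop :=
  (exists2 p, p \in s & modulus p = m) /\
  (forall p, p \in s -> modulus p <= m).

(* Main.v *)
(** The covering below consists of 41 progressions whose moduli divide
    30240 = 32 * 27 * 5 * 7; it was found by simulated annealing on the number
    of uncovered residues modulo 30240.  To verify it, fix the residue of x
    modulo 5, 7, 27 and 32 in turn: a progression a (mod m) survives the choice
    x = r (mod q) when a = r (mod gcd(m, q)), and then, if gcd(m, q) and
    m / gcd(m, q) are coprime, what is left to know is x = a (mod m / gcd(m, q)).
    Each branch must reach a progression of modulus 1. *)

Require Import Defs.
From mathcomp Require Import all_boot all_order all_algebra.

Set Implicit Arguments.
Unset Strict Implicit.
Unset Printing Implicit Defensive.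

(** Discarding progressions that fail the coprimality test is sound: it only leaves fewer
    progressions to cover with. *)
Definition refine (q r : nat) (s : seq (nat * nat)) : seq (nat * nat) :=
  [seq (p.1, p.2 %/ gcdn p.2 q) | p <- s &
     coprime (gcdn p.2 q) (p.2 %/ gcdn p.2 q) && (p.1 == r %[mod gcdn p.2 q])].

Fixpoint covers (qs : seq nat) (s : seq (nat * nat)) : bool :=
  has (fun p => p.2 == 1) s ||
  if qs is q :: qs' then all (fun r => covers qs' (refine q r s)) (iota 0 q)
  else false.

Lemma refineP (q r : nat) (s : seq (nat * nat)) (x : int) (p : nat * nat) :
  (x = r %[mod q])%Z -> p \in refine q r s -> (x = p.1 %[mod p.2])%Z ->
  exists2 p', p' \in s & (x = p'.1 %[mod p'.2])%Z.
Proof.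
move=> xr /mapP[[a m]]; rewrite mem_filter /= => /andP[/andP[co /eqP ar] ps] ->.
move=> /= xa; exists (a, m) => //=; set g := gcdn m q in co ar xa *.
have gq : (g%:Z %| q%:Z)%Z by rewrite dvdzE /= dvdn_gcdr.
apply/eqP; rewrite eqz_mod_dvd.
(* As [g] and [m %/ g] are coprime, it suffices that each divides [x - a]. Modulo [g], a divisor of
   [q], the link from [x] to [a] is [r]. *)
rewrite -(divnK (dvdn_gcdl m q)) mulnC PoszM Gauss_dvdz; last by rewrite coprimezE.
apply/andP; split; last by rewrite -eqz_mod_dvd; apply/eqP.
rewrite -eqz_mod_dvd; apply/eqP; transitivity (r %% g)%Z; last first.
  by rewrite !modz_nat ar.
by apply/eqP; rewrite eqz_mod_dvd (dvdz_trans gq) // -eqz_mod_dvd; apply/eqP.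
Qed.

Lemma coversP (qs : seq nat) (s : seq (nat * nat)) (x : int) :
  all (ltn 0) qs -> covers qs s ->
  exists2 p, p \in s & (x = p.1 %[mod p.2])%Z.
Proof.
elim: qs s => [|q qs IHqs] s /=.
  by rewrite orbF => _ /hasP[p ps /eqP p1]; exists p; rewrite // p1 !modz1.
case/andP=> q_gt0 qs_gt0 /orP[/hasP[p ps /eqP p1]|/allP cov].
  by exists p; rewrite // p1 !modz1.
have q_neq0 : Posz q != 0%R by rewrite -lt0n.
(* The residue of [x], as a natural number, selects the branch to follow. *)
have xE : (x %% q)%Z = `|(x %% q)%Z|%N by rewrite gez0_abs ?modz_ge0.
have r_lt : `|(x %% q)%Z|%N \in iota 0 q.
  by rewrite mem_iota /= add0n -ltz_nat -xE ltz_pmod.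
have [p ps xp] := IHqs _ qs_gt0 (cov _ r_lt).
by apply: refineP ps xp; rewrite -xE modz_mod.
Qed.

Definition covering6_168 : seq (nat * nat) :=
  [:: (4, 6); (3, 7); (7, 8); (8, 9); (1, 10); (0, 12); (1, 14); (13, 15);
      (14, 16); (14, 18); (9, 20); (12, 21); (18, 24); (14, 27); (25, 28);
      (25, 30); (27, 32); (13, 35); (20, 36); (19, 40); (21, 42); (20, 45);
      (6, 48); (23, 54); (51, 56); (37, 60); (47, 63); (37, 70); (2, 72);
      (67, 80); (9, 84); (83, 90); (90, 105); (5, 108); (83, 120); (119, 126);
      (5, 135); (97, 140); (38, 144); (107, 160); (123, 168)].

(** All moduli divide 5 * 7 * 27 * 32, so each gcd is a full prime-power part and the coprimality
    test rejects nothing. *)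
Lemma covers6_168 : covers [:: 5; 7; 27; 32] covering6_168.
Proof. by vm_compute. Qed.

Theorem theorem2 :
  exists s : seq progression,
    [/\ covering_system s,
        distinct_moduli s,
        minimum_modulus s 6
      & maximum_modulus s 168].
Proof.
pose s : seq progression := [seq (Posz p.1, p.2) | p <- covering6_168].
(* These bounds serve three times: positivity, minimum and maximum. *)
have range p : p \in s -> 6 <= modulus p <= 168.
  have : all (fun p => 6 <= modulus p <= 168) s by vm_compute.
  by move/allP; apply.
exists s; split.
- split=> [p /range/andP[m_ge6 _]|x]; first exact: leq_trans m_ge6.
  have [[a m] ps xp] := coversP (qs := [:: 5; 7; 27; 32]) x isT covers6_168.
  exists (Posz a, m); first exact: map_f ps.
  move/eqP: xp; rewrite eqz_mod_dvd => /dvdzP[k xk]; exists k.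
  by rewrite -xk GRing.addrC GRing.subrK.
- by vm_compute.
- split=> [|p /range/andP[] //]; by exists (Posz 4, 6).
- split=> [|p /range/andP[] //]; by exists (Posz 123, 168).
Qed.
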